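(* Let $n$ be any rational number. For $i=1,2$ let $d_i$ be a nonzero real number (with $d_1,d_2>0$ in case $n$, written in lowest terms, has an even denominator), let $a_i,b_i$ be real-valued continuous functions on an interval $J$ containing $0$ and symmetric about $0$, and let $y_i$ be the unique solution, on an interval $I_i\subseteq J$ containing $0$, of the Bernoulli initial-value problem $$\frac{dy_i(t)}{dt}=a_i(t)y_i(t)+b_i(t)y_i^{n}(t),\qquad y_i(0)=d_i .$$ Suppose that one of the following is true: (i) $a_1$ is an even function, $b_1$ is an odd function, $a_2(t)=-a_1(t)$, $b_2(t)=b_1(t)$, and $d_2=d_1$; (ii) $a_1$ is an odd function, $b_1$ is an even function, $a_2(t)=a_1(t)$, $b_2(t)=-b_1(t)$, and $d_2=d_1$; (iii) $a_1$ and $b_1$ are even functions, $a_2(t)=-a_1(t)$, $b_2(t)=-b_1(t)$, and $d_2=d_1$. Then $y_1$ and $y_2$ are symmetric to each other with respect to the $y$-axis, i.e. $y_2(-t)=y_1(t)$.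
   Context: Everything is real-valued. Write $n=p/q$ in lowest terms with $q>0$; $y^{n}$ means $(y^{1/q})^{p}$ with $y^{1/q}$ the real $q$-th root (for $q$ odd it is defined for all real $y$; for $q$ even it is the nonnegative root, defined for $y\ge 0$, and solutions are required to be nonnegative); $y^0=1$; if $n<0$, solutions are nonvanishing. Intervals are nondegenerate. ''The unique solution on $I_i$'' means that $I_i$ is an interval containing $0$ on which the $i$-th initial-value problem has exactly one solution, denoted $y_i$. The identity $y_2(-t)=y_1(t)$ is understood for all $t$ with $t\in I_1$ and $-t\in I_2$. *)

(* Defs.v *)
From Stdlib Require Export Reals QArith.
From Stdlib Require Import ZArith Lra Lia.
Open Scope R_scope.

(* Real q-th root: the odd extension to x < 0 when q is odd; for q even it is
   the nonnegative root of x >= 0, and x < 0 gets the junk value 0. *)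
Definition real_root (q : positive) (x : R) : R :=
  if Rlt_dec 0 x then Rpower x (/ IZR (Z.pos q))
  else if Rlt_dec x 0 then
    (if Z.odd (Z.pos q) then - Rpower (- x) (/ IZR (Z.pos q)) else 0)
  else 0.

Lemma real_root_pow (q : positive) (x : R) :
  Z.Odd (Z.pos q) \/ 0 <= x -> real_root q x ^ Pos.to_nat q = x.
Proof.
  assert (Hpos : forall z, 0 < z ->
            Rpower z (/ IZR (Z.pos q)) ^ Pos.to_nat q = z).
  { intros z Hz. rewrite <- Rpower_pow by apply exp_pos.
    rewrite Rpower_mult, INR_IZR_INZ, positive_nat_Z, Rinv_l.
    - now apply Rpower_1.
    - now apply not_0_IZR. }
  intros Hq. unfold real_root.
  destruct (Rlt_dec 0 x) as [Hx|Hx]; [now apply Hpos|].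
  destruct (Rlt_dec x 0) as [Hx'|Hx'].
  - destruct Hq as [Hq|Hq]; [|lra].
    assert (Ho : Z.odd (Z.pos q) = true) by now apply Z.odd_spec.
    rewrite Ho.
    destruct Hq as [k Hk].
    assert (Hn : Pos.to_nat q = S (2 * Z.to_nat k)) by lia.
    specialize (Hpos (- x) ltac:(lra)). rewrite Hn in *.
    set (r := Rpower _ _) in *.
    replace (- r) with (-1 * r) by ring.
    rewrite Rpow_mult_distr, pow_1_odd, Hpos. ring.
  - assert (x = 0) as -> by lra.
    apply pow_i, Pos2Nat.is_pos.
Qed.

Lemma real_root_ge0 (q : positive) (x : R) : 0 <= x -> 0 <= real_root q x.
Proof.
  intros Hx. unfold real_root.
  destruct (Rlt_dec 0 x); [left; apply exp_pos|].
  destruct (Rlt_dec x 0); lra.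
Qed.

(* [Qred] puts n in lowest terms; [powerRZ y 0 = 1] for every y. *)
Definition Rpow_rat (y : R) (n : Q) : R :=
  powerRZ (real_root (Qden (Qred n)) y) (Qnum (Qred n)).

Definition even_den (n : Q) : Prop := Z.Even (Z.pos (Qden (Qred n))).

Definition interval (J : R -> Prop) : Prop :=
  (forall x y z, J x -> J z -> x <= y <= z -> J y) /\
  (exists x y, J x /\ J y /\ x < y).

Definition symmetric_set (J : R -> Prop) : Prop := forall t, J t -> J (- t).

Definition continuous_on (f : R -> R) (J : R -> Prop) : Prop :=
  forall t, J t -> continue_in f J t.

Definition even_on (f : R -> R) (J : R -> Prop) : Prop :=
  forall t, J t -> f (- t) = f t.

Definition odd_on (f : R -> R) (J : R -> Prop) : Prop :=
  forall t, J t -> f (- t) = - f t.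

(* [D_in] is the derivative relative to I, hence one-sided at an endpoint of I. *)
Definition bernoulli_solution (n : Q) (a b : R -> R) (d : R)
    (I : R -> Prop) (y : R -> R) : Prop :=
  (forall t, I t -> D_in y (fun s => a s * y s + b s * Rpow_rat (y s) n) I t) /\
  y 0 = d /\
  (even_den n -> forall t, I t -> 0 <= y t) /\
  ((n < 0)%Q -> forall t, I t -> y t <> 0).

(* Functions are total on R, so uniqueness means equality on I only. *)
Definition unique_bernoulli_solution (n : Q) (a b : R -> R) (d : R)
    (I : R -> Prop) (y : R -> R) : Prop :=
  bernoulli_solution n a b d I y /\
  (forall z, bernoulli_solution n a b d I z -> forall t, I t -> z t = y t).

(* Main.v *)
Require Import Defs.
From Stdlib Require Import Reals QArith Rtopology.
From Stdlib Require Import Lra Classical.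
Open Scope R_scope.

(** Reflection [t |-> - t] turns a solution [y2] of the second problem into a
    solution of the problem with coefficients [- a2 (- t)] and [- b2 (- t)], and
    each of the three parity hypotheses says exactly that these are [a1] and
    [b1].  So [y1] and the reflection of [y2] solve the same initial-value
    problem, each being the unique solution on its own interval, [I1] and
    [- I2] respectively.

    Uniqueness on an interval does not immediately give uniqueness on the smaller
    interval [I1 /\ - I2], because a solution there might not extend; for
    [0 < n < 1] solutions can branch where they vanish, so no Lipschitz argument
    applies either.  Instead, look at one side of 0 at a time.  The
    parts of the two intervals lying in [t >= 0] are comparable for inclusion.
    On the interval with the smaller part, follow the other solution
    for [t >= 0] and its own solution for [t < 0]: the two halves have the same
    value at 0, hence the same slope there, so this is a solution
    ([bernoulli_solution_splice]) and uniqueness on that interval makes the two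
    solutions agree for [t >= 0] ([unique_solutions_agree_right]).  The side
    [t <= 0] is the reflected statement. *)

(** * Relative derivatives *)

Lemma D_in_local (f g d d' : R -> R) (K I : R -> Prop) (t r : R) :
  0 < r ->
  (forall x, I x -> Rabs (x - t) < r -> K x /\ g x = f x) ->
  g t = f t -> d' t = d t ->
  D_in f d K t -> D_in g d' I t.
Proof.
  intros Hr Hloc Ht Hd H eps Heps.
  destruct (H eps Heps) as [alp [Halp Hlim]].
  exists (Rmin alp r); split; [now apply Rmin_pos|].
  simpl in *; unfold Rdist in *.
  intros x [[HIx Hne] Hx].
  destruct (Hloc x HIx) as [HKx Hgx].
  { eapply Rlt_le_trans; [exact Hx | apply Rmin_r]. }
  rewrite Hgx, Ht, Hd.
  apply Hlim; repeat split; auto.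
  eapply Rlt_le_trans; [exact Hx | apply Rmin_l].
Qed.

Lemma D_in_two_sided (f d : R -> R) (I : R -> Prop) (t : R) :
  D_in f d (fun s => I s /\ t <= s) t ->
  D_in f d (fun s => I s /\ s <= t) t ->
  D_in f d I t.
Proof.
  intros Hr Hl eps Heps.
  destruct (Hr eps Heps) as [ar [Har Hlimr]].
  destruct (Hl eps Heps) as [al [Hal Hliml]].
  exists (Rmin ar al); split; [now apply Rmin_pos|].
  simpl in *; unfold Rdist in *.
  intros x [[HIx Hne] Hx].
  destruct (Rle_or_lt t x).
  - apply Hlimr; repeat split; auto.
    eapply Rlt_le_trans; [exact Hx | apply Rmin_l].
  - apply Hliml; repeat split; auto; [lra|].
    eapply Rlt_le_trans; [exact Hx | apply Rmin_r].
Qed.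

Lemma D_in_reflect (f d : R -> R) (I : R -> Prop) (t : R) :
  D_in f d I (- t) ->
  D_in (fun s => f (- s)) (fun s => - d (- s)) (fun s => I (- s)) t.
Proof.
  intros H eps Heps.
  destruct (H eps Heps) as [alp [Halp Hlim]].
  exists alp; split; [exact Halp|].
  simpl in *; unfold Rdist in *.
  intros x [[HIx Hne] Hx].
  replace ((f (- x) - f (- t)) / (x - t) - - d (- t))
    with (- ((f (- x) - f (- t)) / (- x - - t) - d (- t))) by (field; lra).
  rewrite Rabs_Ropp.
  apply Hlim; repeat split; auto.
  - lra.
  - now replace (- x - - t) with (- (x - t)) by ring; rewrite Rabs_Ropp.
Qed.

(** * Operations on solutions of the Bernoulli problem *)

Lemma bernoulli_solution_ext (n : Q) (a b a' b' : R -> R) (d : R)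
    (I I' : R -> Prop) (y y' : R -> R) :
  (forall t, I' t <-> I t) ->
  (forall t, I t -> a' t = a t) -> (forall t, I t -> b' t = b t) ->
  (forall t, y' t = y t) ->
  bernoulli_solution n a b d I y -> bernoulli_solution n a' b' d I' y'.
Proof.
  intros HI Ha Hb Hy (Hode & H0 & Hge & Hnz).
  repeat split.
  - intros t Ht. apply HI in Ht.
    apply (D_in_local y y' _ _ I I' t 1 Rlt_0_1) with (4 := Hode t Ht).
    + intros x Hx _. split; [now apply HI | apply Hy].
    + apply Hy.
    + now rewrite Ha, Hb, Hy.
  - now rewrite Hy.
  - intros He t Ht. rewrite Hy. now apply Hge, HI.
  - intros Hn t Ht. rewrite Hy. now apply Hnz, HI.
Qed.

Lemma bernoulli_solution_reflect (n : Q) (a b : R -> R) (d : R)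
    (I : R -> Prop) (y : R -> R) :
  bernoulli_solution n a b d I y ->
  bernoulli_solution n (fun t => - a (- t)) (fun t => - b (- t)) d
    (fun t => I (- t)) (fun t => y (- t)).
Proof.
  intros (Hode & H0 & Hge & Hnz).
  repeat split; auto.
  - intros t Ht.
    apply (D_in_local (fun s => y (- s)) _ _ _ (fun s => I (- s)) _ t 1 Rlt_0_1)
      with (4 := D_in_reflect _ _ _ _ (Hode _ Ht)); auto.
    ring.
  - now rewrite Ropp_0.
Qed.

(** Reflection is an involution, so a competitor of the reflected solution
    reflects back to a competitor of the original one. *)
Lemma unique_bernoulli_solution_reflect (n : Q) (a b a' b' : R -> R) (d : R)
    (I : R -> Prop) (y : R -> R) :
  (forall t, I (- t) -> a' t = - a (- t)) ->
  (forall t, I (- t) -> b' t = - b (- t)) ->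
  unique_bernoulli_solution n a b d I y ->
  unique_bernoulli_solution n a' b' d (fun t => I (- t)) (fun t => y (- t)).
Proof.
  intros Ha Hb [Hsol Huniq]. split.
  - apply (bernoulli_solution_ext n (fun t => - a (- t)) (fun t => - b (- t))
             _ _ d (fun t => I (- t)) _ (fun t => y (- t))); auto.
    + reflexivity.
    + now apply bernoulli_solution_reflect.
  - intros z Hz t Ht.
    rewrite <- (Huniq (fun s => z (- s))); [now rewrite Ropp_involutive | | exact Ht].
    apply (bernoulli_solution_ext n (fun t => - a' (- t)) (fun t => - b' (- t))
             _ _ d (fun t => I (- - t)) _ (fun t => z (- t))); auto.
    + intros s. now rewrite Ropp_involutive.
    + intros s Hs. rewrite Ha by exact Hs. now rewrite !Ropp_involutive.
    + intros s Hs. rewrite Hb by exact Hs. now rewrite !Ropp_involutive.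
    + now apply (bernoulli_solution_reflect n a' b' d (fun t => I (- t))).
Qed.

(** The only delicate point is 0, where the two one-sided slopes agree because
    the equation determines the slope from the common value [d]. *)
Lemma bernoulli_solution_splice (n : Q) (a b : R -> R) (d : R)
    (I K : R -> Prop) (y z : R -> R) :
  (forall t, 0 <= t -> I t -> K t) ->
  bernoulli_solution n a b d I y -> bernoulli_solution n a b d K z ->
  bernoulli_solution n a b d I (fun t => if Rle_dec 0 t then z t else y t).
Proof.
  intros HIK (Hyode & Hy0 & Hyge & Hynz) (Hzode & Hz0 & Hzge & Hznz).
  set (w := fun t => if Rle_dec 0 t then z t else y t).
  assert (Hw : forall t, 0 <= t -> w t = z t).
  { intros t Ht. unfold w. destruct (Rle_dec 0 t); [reflexivity | lra]. }
  assert (Hw' : forall t, t <= 0 -> w t = y t).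
  { intros t Ht. unfold w. destruct (Rle_dec 0 t); [|reflexivity].
    assert (t = 0) as -> by lra. congruence. }
  repeat split.
  - intros t Ht.
    destruct (Rtotal_order t 0) as [Hlt | [-> | Hgt]].
    + apply (D_in_local y w _ _ I I t (- t)) with (5 := Hyode t Ht); [lra | | |].
      * intros x Hx Hxt. apply Rabs_def2 in Hxt. split; [|apply Hw']; auto; lra.
      * apply Hw'; lra.
      * now rewrite Hw' by lra.
    + apply D_in_two_sided.
      * apply (D_in_local z w _ _ K _ 0 1 Rlt_0_1)
          with (4 := Hzode 0 (HIK 0 (Rle_refl 0) Ht)).
        -- intros x [Hx Hx0] _. auto.
        -- apply Hw; lra.
        -- now rewrite Hw by lra.
      * apply (D_in_local y w _ _ I _ 0 1 Rlt_0_1) with (4 := Hyode 0 Ht).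
        -- intros x [Hx Hx0] _. auto.
        -- apply Hw'; lra.
        -- now rewrite Hw' by lra.
    + assert (HKt : K t) by (apply HIK; auto; lra).
      apply (D_in_local z w _ _ K I t t) with (5 := Hzode t HKt); [lra | | |].
      * intros x Hx Hxt. apply Rabs_def2 in Hxt.
        split; [apply HIK | apply Hw]; auto; lra.
      * apply Hw; lra.
      * now rewrite Hw by lra.
  - rewrite Hw by lra. exact Hz0.
  - intros He t Ht. unfold w. destruct (Rle_dec 0 t); auto.
  - intros Hn t Ht. unfold w. destruct (Rle_dec 0 t); auto.
Qed.

(** * Agreement of unique solutions on different intervals *)

Lemma unique_solution_agrees_right (n : Q) (a b : R -> R) (d : R)
    (I K : R -> Prop) (y z : R -> R) :
  (forall t, 0 <= t -> I t -> K t) ->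
  unique_bernoulli_solution n a b d I y -> bernoulli_solution n a b d K z ->
  forall t, 0 <= t -> I t -> z t = y t.
Proof.
  intros HIK [Hy Huniq] Hz t Ht0 Ht.
  rewrite <- (Huniq _ (bernoulli_solution_splice n a b d I K y z HIK Hy Hz) t Ht).
  destruct (Rle_dec 0 t); [reflexivity | lra].
Qed.

(** Two intervals containing 0 have comparable nonnegative parts, and the
    uniqueness that is used is the one on the smaller part. *)
Lemma unique_solutions_agree_right (n : Q) (a b : R -> R) (d : R)
    (I K : R -> Prop) (y z : R -> R) :
  interval I -> I 0 -> interval K -> K 0 ->
  unique_bernoulli_solution n a b d I y ->
  unique_bernoulli_solution n a b d K z ->
  forall t, 0 <= t -> I t -> K t -> z t = y t.
Proof.
  intros [HI _] HI0 [HK _] HK0 Hy Hz t Ht0 HIt HKt.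
  destruct (classic (forall s, 0 <= s -> I s -> K s)) as [HIK | HIK].
  - now apply (unique_solution_agrees_right n a b d I K y z HIK Hy (proj1 Hz)).
  - symmetry.
    apply (unique_solution_agrees_right n a b d K I z y); auto; [|exact (proj1 Hy)].
    intros r Hr HKr.
    apply NNPP. intros HIr. apply HIK. intros s Hs HIs.
    apply (HK 0 s r HK0 HKr).
    destruct (Rle_or_lt s r); [lra|].
    exfalso. apply HIr, (HI 0 r s HI0 HIs). lra.
Qed.

Lemma interval_reflect (I : R -> Prop) :
  interval I -> interval (fun t => I (- t)).
Proof.
  intros [Hconv (x & y & Hx & Hy & Hxy)]. split.
  - intros u v w Hu Hw Huvw. apply (Hconv (- w) (- v) (- u)); auto; lra.
  - exists (- y), (- x). rewrite !Ropp_involutive. repeat split; auto; lra.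
Qed.

Lemma unique_solutions_agree (n : Q) (a b : R -> R) (d : R)
    (I K : R -> Prop) (y z : R -> R) :
  interval I -> I 0 -> interval K -> K 0 ->
  unique_bernoulli_solution n a b d I y ->
  unique_bernoulli_solution n a b d K z ->
  forall t, I t -> K t -> z t = y t.
Proof.
  intros HI HI0 HK HK0 Hy Hz t HIt HKt.
  destruct (Rle_or_lt 0 t) as [Ht | Ht].
  - now apply (unique_solutions_agree_right n a b d I K).
  - rewrite <- (Ropp_involutive t) in HIt, HKt |- *.
    apply (unique_solutions_agree_right n (fun s => - a (- s)) (fun s => - b (- s)) d
             (fun s => I (- s)) (fun s => K (- s))
             (fun s => y (- s)) (fun s => z (- s))); auto using interval_reflect.
    + now rewrite Ropp_0.
    + now rewrite Ropp_0.
    + now apply (unique_bernoulli_solution_reflect n a b).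
    + now apply (unique_bernoulli_solution_reflect n a b).
    + lra.
Qed.

Theorem theorem3 (n : Q) (d1 d2 : R) (J I1 I2 : R -> Prop)
    (a1 b1 a2 b2 y1 y2 : R -> R)
    (hd1 : d1 <> 0) (hd2 : d2 <> 0)
    (hd_even : even_den n -> 0 < d1 /\ 0 < d2)
    (hJ : interval J) (hJ0 : J 0) (hJsym : symmetric_set J)
    (ha1 : continuous_on a1 J) (hb1 : continuous_on b1 J)
    (ha2 : continuous_on a2 J) (hb2 : continuous_on b2 J)
    (hI1 : interval I1) (hI1_0 : I1 0) (hI1J : included I1 J)
    (hI2 : interval I2) (hI2_0 : I2 0) (hI2J : included I2 J)
    (hy1 : unique_bernoulli_solution n a1 b1 d1 I1 y1)
    (hy2 : unique_bernoulli_solution n a2 b2 d2 I2 y2)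
    (hcases :
      (even_on a1 J /\ odd_on b1 J /\
       (forall t, J t -> a2 t = - a1 t) /\ (forall t, J t -> b2 t = b1 t) /\
       d2 = d1)
      \/
      (odd_on a1 J /\ even_on b1 J /\
       (forall t, J t -> a2 t = a1 t) /\ (forall t, J t -> b2 t = - b1 t) /\
       d2 = d1)
      \/
      (even_on a1 J /\ even_on b1 J /\
       (forall t, J t -> a2 t = - a1 t) /\ (forall t, J t -> b2 t = - b1 t) /\
       d2 = d1)) :
  forall t, I1 t -> I2 (- t) -> y2 (- t) = y1 t.
Proof.
  assert (Hd : d2 = d1) by tauto.
  subst d2.
  assert (Hcoef : forall t, J t -> a1 t = - a2 (- t) /\ b1 t = - b2 (- t)).
  { intros t Ht. pose proof (hJsym t Ht) as Ht'.
    destruct hcases as [(Ha & Hb & Ha2 & Hb2 & _)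
                       |[(Ha & Hb & Ha2 & Hb2 & _)|(Ha & Hb & Ha2 & Hb2 & _)]];
      rewrite (Ha2 _ Ht'), (Hb2 _ Ht'), (Ha t Ht), (Hb t Ht); lra. }
  assert (HJ2 : forall t, I2 (- t) -> J t).
  { intros t Ht. rewrite <- (Ropp_involutive t). now apply hJsym, hI2J. }
  apply (unique_solutions_agree n a1 b1 d1 I1 (fun s => I2 (- s)) y1
           (fun s => y2 (- s))); auto using interval_reflect.
  - now rewrite Ropp_0.
  - apply (unique_bernoulli_solution_reflect n a2 b2); auto;
      intros t Ht; now apply Hcoef, HJ2.
Qed.
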